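(* For every fixed $k \ge 3$, the $k$-dimensional \textsc{Tarski} problem on a lattice of width $n$ can be solved using $O(\log^{k-1} n)$ queries to $f$.
   Context: For positive integers $n_1,\dots,n_k$, the lattice $L = L(n_1,\dots,n_k)$ is the set of all $x \in \mathbb{N}^k$ with $1 \le x_i \le n_i$ for all $i$, ordered by $x \preceq y$ iff $x_i \le y_i$ for all $i$; its width is $n = \max_i n_i$. The \textsc{Tarski} problem: given oracle (query) access to a function $f : L \to L$, find either (T1) a point $x \in L$ with $f(x) = x$, or (T2) two points $x, y \in L$ with $x \preceq y$ and $f(x) \not\preceq f(y)$ (a violation of order preservation). A query is one evaluation of $f$ at a point; the query complexity counts the number of evaluations. *)

(* Defs.v *)
From HB Require Import structures.
From mathcomp Require Import all_boot all_order all_algebra.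
From mathcomp Require Import all_classical all_reals all_analysis.

Set Implicit Arguments.
Unset Strict Implicit.
Unset Printing Implicit Defensive.

Definition in_lattice (k : nat) (dims : 'I_k -> nat)
    (x : {ffun 'I_k -> nat}) : bool :=
  [forall i, (1 <= x i <= dims i)%N].

Definition lattice (k : nat) (dims : 'I_k -> nat) : Type :=
  {x : {ffun 'I_k -> nat} | in_lattice dims x}.

Definition preceq (k : nat) (dims : 'I_k -> nat) (x y : lattice dims) : Prop :=
  forall i, (val x i <= val y i)%N.

Definition width (k : nat) (dims : 'I_k -> nat) : nat := \max_(i < k) dims i.

(* A deterministic adaptive query algorithm, as a decision tree: it either
   stops with an output, or queries the oracle at a point of [A] and continues
   according to the value received. *)
Inductive query_alg (A B Out : Type) : Type :=
| Return of Out
| Query of A & (B -> query_alg A B Out).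

Fixpoint run (A B Out : Type) (f : A -> B) (t : query_alg A B Out) : Out :=
  match t with
  | Return o => o
  | Query a next => run f (next (f a))
  end.

Fixpoint num_queries (A B Out : Type) (f : A -> B)
    (t : query_alg A B Out) : nat :=
  match t with
  | Return _ => 0
  | Query a next => (num_queries f (next (f a))).+1
  end.

Inductive tarski_output (T : Type) : Type :=
| FixedPoint of T
| Violation of T & T.

(* The oracle [f] is not assumed to be order preserving. *)
Definition tarski_solution (k : nat) (dims : 'I_k -> nat)
    (f : lattice dims -> lattice dims)
    (o : tarski_output (lattice dims)) : Prop :=
  match o with
  | FixedPoint x => f x = x
  | Violation x y => preceq x y /\ ~ preceq (f x) (f y)
  end.

(* The algorithm may depend on the lattice, but not on [f]. *)
Definition tarski_solvable_within (k : nat) (dims : 'I_k -> nat)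
    (q : nat) : Prop :=
  exists t : query_alg (lattice dims) (lattice dims)
                       (tarski_output (lattice dims)),
    forall f : lattice dims -> lattice dims,
      tarski_solution f (run f t) /\ (num_queries f t <= q)%N.

(* Main.v *)
Require Import Defs.
From Stdlib Require Import ZArith Lia.
From HB Require Import structures.
From mathcomp Require Import all_boot all_order all_algebra.
From mathcomp Require Import all_classical all_reals all_analysis.
From mathcomp Require Import zify.
Import Order.TTheory GRing.Theory Num.Theory.
Import numFieldNormedType.Exports.

Set Implicit Arguments.
Unset Strict Implicit.
Unset Printing Implicit Defensive.

(** Any partial function without a violation of monotonicity extends to a
    monotone function on the lattice. So an algorithm that is correct for
    monotone oracles is correct for all oracles, once it also keeps its query
    history and reports a violation found there.

    For a monotone oracle, a dimension is added by binary search on the last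
    coordinate: the fixed point of the slice found by recursion decides the half
    in which to go on. This costs a factor [log n] per dimension, hence
    [log^k n] altogether. One factor is saved in dimension three. There it
    suffices to find in each planar slice a point at which the three
    displacements [f(x)_i - x_i] have the same weak sign, and this takes only
    [O(log n)] queries. The planar search shrinks a box whose top-right corner
    [b] need not be mapped below itself; instead a segment [d, b] of the
    boundary certifies that it contains either a point where all displacements
    are nonnegative or a point that the planar map sends below itself. Dually
    for the bottom-left corner. *)

(** * Query algorithms under a promise on the oracle, and their composition *)

Section Solve.
Variables A B : Type.

(** [K] is what is known of the oracle: a promise at first, later also the answers received. Where
    this knowledge is contradictory, any output will do. *)
Definition solves (O : Type) (q : nat) (K : (A -> B) -> Prop)
    (P : (A -> B) -> O -> Prop) : Prop :=
  exists t : query_alg A B O,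
    forall f, K f -> P f (run f t) /\ (num_queries f t <= q)%N.

Lemma solves_ret O (o : O) q (K : (A -> B) -> Prop) (P : (A -> B) -> O -> Prop) :
  (forall f, K f -> P f o) -> solves q K P.
Proof. by move=> H; exists (Return _ _ o) => f Kf; split; [exact: H|]. Qed.

Lemma solves_query O (a : A) q (K : (A -> B) -> Prop) (P : (A -> B) -> O -> Prop) :
  (forall b, solves q (fun f => K f /\ f a = b) P) -> solves q.+1 K P.
Proof.
move=> /choice [t Ht]; exists (Query a t) => f Kf /=.
by rewrite ltnS; apply: Ht.
Qed.

Lemma solves_weaken O q q' (K K' : (A -> B) -> Prop) (P P' : (A -> B) -> O -> Prop) :
  solves q K P -> (q <= q')%N -> (forall f, K' f -> K f) ->
  (forall f o, K' f -> P f o -> P' f o) -> solves q' K' P'.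
Proof.
move=> [t Ht] leq KK PP; exists t => f Kf.
have [Pt nt] := Ht f (KK f Kf); split; first exact: PP.
exact: leq_trans nt leq.
Qed.

Fixpoint bind (O O' : Type) (t : query_alg A B O) (u : O -> query_alg A B O') :=
  match t with
  | Return o => u o
  | Query a next => Query a (fun b => bind (next b) u)
  end.

Lemma run_bind O O' f (t : query_alg A B O) (u : O -> query_alg A B O') :
  run f (bind t u) = run f (u (run f t)).
Proof. by elim: t => //= a next IH. Qed.

Lemma num_queries_bind O O' f (t : query_alg A B O) (u : O -> query_alg A B O') :
  num_queries f (bind t u) = (num_queries f t + num_queries f (u (run f t)))%N.
Proof. by elim: t => //= a next IH; rewrite IH addSn. Qed.

Lemma solves_bind O O' q q' (K : (A -> B) -> Prop)
    (P : (A -> B) -> O -> Prop) (P' : (A -> B) -> O' -> Prop) :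
  solves q K P -> (forall o, solves q' (fun f => K f /\ P f o) P') ->
  solves (q + q') K P'.
Proof.
move=> [t Ht] /choice [u Hu]; exists (bind t u) => f Kf.
have [Pt nt] := Ht f Kf; have [Pu nu] := Hu _ f (conj Kf Pt).
by rewrite run_bind num_queries_bind; split=> //; apply: leq_add.
Qed.

End Solve.

Section Simulation.
Variables (A B A' B' O O' : Type).
Variables (enc : A' -> A) (dec : B -> B') (post : O' -> O).

Fixpoint sim (t : query_alg A' B' O') : query_alg A B O :=
  match t with
  | Return o => Return _ _ (post o)
  | Query a next => Query (enc a) (fun b => sim (next (dec b)))
  end.

(** Each query to the simulated oracle costs one query to [f], so passing to a slice, negating,
    transposing and recoding are all free. *)
Lemma solves_sim q (K' : (A' -> B') -> Prop) (P' : (A' -> B') -> O' -> Prop)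
    (K : (A -> B) -> Prop) (P : (A -> B) -> O -> Prop) :
  solves q K' P' ->
  (forall f, K f -> K' (fun x => dec (f (enc x)))) ->
  (forall f o, K f -> P' (fun x => dec (f (enc x))) o -> P f (post o)) ->
  solves q K P.
Proof.
move=> [t Ht] KK PP; exists (sim t) => f Kf.
have [Pt nt] := Ht _ (KK f Kf); have := PP f _ Kf Pt.
have -> : run f (sim t) = post (run (fun x => dec (f (enc x))) t).
  by elim: t {Ht Pt nt} => //= a next IH; rewrite IH.
suff -> : num_queries f (sim t) = num_queries (fun x => dec (f (enc x))) t by [].
by elim: t {Ht Pt nt} => //= a next IH; rewrite IH.
Qed.

End Simulation.

Local Open Scope Z_scope.

(** * Integer boxes, and adding one dimension by binary search *)

Fixpoint vec (j : nat) : Type := if j is i.+1 then (vec i * Z)%type else unit.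

Fixpoint vle (j : nat) : vec j -> vec j -> Prop :=
  match j return vec j -> vec j -> Prop with
  | 0%N => fun _ _ => True
  | i.+1 => fun x y => vle x.1 y.1 /\ x.2 <= y.2
  end.

Fixpoint vwidth_lt (j : nat) (w : Z) : vec j -> vec j -> Prop :=
  match j return vec j -> vec j -> Prop with
  | 0%N => fun _ _ => True
  | i.+1 => fun x y => vwidth_lt w x.1 y.1 /\ y.2 - x.2 < w
  end.

Lemma vle_refl j (x : vec j) : vle x x.
Proof. by elim: j x => //= j IH [x z] /=; split; [exact: IH|lia]. Qed.

Lemma vle_trans j (y x z : vec j) : vle x y -> vle y z -> vle x z.
Proof.
elim: j x y z => //= j IH x y z [h1 h2] [h3 h4]; split; [exact: IH h1 h3|lia].
Qed.

Lemma vwidth_lt_sub j w (x y x' y' : vec j) :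
  vwidth_lt w x y -> vle x x' -> vle y' y -> vwidth_lt w x' y'.
Proof.
elim: j x y x' y' => //= j IH x y x' y' [h1 h2] [h3 h4] [h5 h6].
by split; [exact: IH h1 h3 h5|lia].
Qed.

Lemma vle_pair j (x y : vec j) (s t : Z) :
  vle x y -> s <= t -> @vle j.+1 (x, s) (y, t).
Proof. by []. Qed.

Definition vmono j (h : vec j -> vec j) := forall x y, vle x y -> vle (h x) (h y).

(** By Tarski's theorem these corner conditions guarantee a fixed point in the box; every search
    step restores them on a smaller box. *)
Definition bracket j (a b : vec j) (h : vec j -> vec j) :=
  [/\ vmono h, vle a b, vle a (h a) & vle (h b) b].

Definition fixed_in j (a b : vec j) (h : vec j -> vec j) (p : vec j) :=
  [/\ vle a p, vle p b & h p = p].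

Definition box_solvable j (w : Z) q :=
  forall a b : vec j, vwidth_lt w a b -> solves q (bracket a b) (fixed_in a b).

Lemma slice_bracket j (a b : vec j) (al bl m : Z) (h : vec j.+1 -> vec j.+1) :
  @bracket j.+1 (a, al) (b, bl) h -> al <= m <= bl ->
  bracket a b (fun x => (h (x, m)).1).
Proof.
move=> [mh [/= hab hl] [/= ha hal] [/= hb hbl]] hm; split=> //.
- move=> x y xy; exact: (mh _ _ (vle_pair xy (Z.le_refl m))).1.
- exact: vle_trans ha (mh _ _ (vle_pair (vle_refl a) (proj1 hm))).1.
- exact: vle_trans (mh _ _ (vle_pair (vle_refl b) (proj2 hm))).1 hb.
Qed.

Lemma solves_slice j (a b : vec j) (al bl m : Z) q w :
  box_solvable j w q -> vwidth_lt w a b -> al <= m <= bl ->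
  solves q (@bracket j.+1 (a, al) (b, bl))
    (fun h p => fixed_in a b (fun x => (h (x, m)).1) p).
Proof.
move=> Hj wab hm.
apply: (solves_sim (enc := fun x => (x, m)) (dec := fst) (post := id) (Hj a b wab)).
- by move=> h Hh; apply: slice_bracket Hh hm.
- by [].
Qed.

Definition pow2 (n : nat) : Z := 2 ^ Z.of_nat n.

Lemma pow20 : pow2 0 = 1. Proof. by []. Qed.

Lemma pow2S n : pow2 n.+1 = 2 * pow2 n.
Proof. by rewrite /pow2 Nat2Z.inj_succ Z.pow_succ_r //; lia. Qed.

Lemma pow2_gt0 n : 0 < pow2 n.
Proof. by rewrite /pow2; lia. Qed.

Lemma pow2_le m n : (m <= n)%N -> pow2 m <= pow2 n.
Proof. by move=> mn; apply: Z.pow_le_mono_r; lia. Qed.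

Lemma Z_halfP s : exists m, 2 * m <= s < 2 * m + 2.
Proof.
exists (s / 2); have := Z.div_mod s 2 _; have := Z.mod_pos_bound s 2 _.
by move=> /(_ erefl) h1 h2; have {}h2 := h2 (fun e => match e with end); lia.
Qed.

(** There are [n] halvings, each solving one slice and making one query, and then one last slice. *)
Definition step_cost (n q : nat) : nat := n.+1 * q + n.

Lemma box_step_aux j w q n (a b : vec j) (al bl : Z) :
  box_solvable j w q -> vwidth_lt w a b -> bl - al < pow2 n ->
  solves (step_cost n q) (@bracket j.+1 (a, al) (b, bl))
    (@fixed_in j.+1 (a, al) (b, bl)).
Proof.
move=> Hj; elim: n a b al bl => [|n IH] a b al bl wab wl.
  rewrite pow20 in wl.
  case: (Z_le_gt_dec al bl) => hl; last first.
    apply: (solves_ret (o := (a, al))) => h [_ /= [_ hh]]; lia.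
  have e : bl = al by lia.
  subst bl.
  have hm : al <= al <= al by lia.
  rewrite /step_cost mul1n -(addnC 0%N) addnC.
  (* The two corners squeeze the last coordinate, so a fixed point of the only slice left is a fixed
     point of [h], without a further query. *)
  apply: (solves_bind (solves_slice Hj wab hm)) => p.
  apply: (solves_ret (o := (p, al))) => h [[mh [/= hab _] [/= ha hal] [/= hb hbl]] [ap pb hp]].
  have [_ /= h1] := mh (a, al) (p, al) (conj ap (Z.le_refl al)).
  have [_ /= h2] := mh (p, al) (b, al) (conj pb (Z.le_refl al)).
  split; [by split=> //=; lia|by split=> //=; lia|].
  by case: (h (p, al)) hp h1 h2 => /= x y -> ? ?; congr (_, _); lia.
case: (Z_le_gt_dec al bl) => hl; last first.
  apply: (solves_ret (o := (a, al))) => h [_ /= [_ hh]]; lia.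
rewrite pow2S in wl.
have [m m2] := Z_halfP (al + bl).
have hm : al <= m <= bl by lia.
have -> : step_cost n.+1 q = (q + (step_cost n q).+1)%N by rewrite /step_cost; lia.
apply: (solves_bind (solves_slice Hj wab hm)) => p.
apply: (solves_query (a := (p, m))) => -[v1 v2].
have [pab|npab] := pselect (vle a p /\ vle p b); last first.
  by apply: (solves_ret (o := (a, al))) => h [[_ [ap pb _]]]; case: npab.
case: pab => ap pb.
(* If the last coordinate drops at [(p, m)], then [(p, m - 1)] is mapped below itself and becomes
   the top corner; if it rises, [(p, m + 1)] becomes the bottom corner. *)
case: (Z.lt_trichotomy v2 m) => [lt|[eq|gt]].
- apply: (solves_weaken (IH a p al (m - 1) _ _)) => //.
  + exact: vwidth_lt_sub wab (vle_refl a) pb.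
  + by lia.
  + move=> h [[[mh [/= hab _] [/= ha hal] [/= hb hbl]] [_ _ hp]] hpm].
    rewrite hpm /= in hp; subst v1.
    have [_] := mh (a, al) (p, m) (conj ap (proj1 hm)); rewrite hpm /= => h1.
    have /(vle_pair (vle_refl p)) : m - 1 <= m by lia.
    move=> /mh [].
    rewrite hpm /= => h2 h3.
    by split=> //; split=> //=; lia.
  + move=> h o _ [/= h1 [h2 h2'] h3]; split=> //=.
    by split; [exact: vle_trans h2 pb|lia].
- subst v2; apply: (solves_ret (o := (p, m))) => h [[_ [_ _ hp]] hpm].
  rewrite hpm /= in hp; subst v1.
  by split=> //; split=> //=; lia.
- apply: (solves_weaken (IH p b (m + 1) bl _ _)) => //.
  + exact: vwidth_lt_sub wab ap (vle_refl b).
  + by lia.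
  + move=> h [[[mh [/= hab _] [/= ha hal] [/= hb hbl]] [_ _ hp]] hpm].
    rewrite hpm /= in hp; subst v1.
    have [_] := mh (p, m) (b, bl) (conj pb (proj2 hm)); rewrite hpm /= => h1.
    have /(vle_pair (vle_refl p)) : m <= m + 1 by lia.
    move=> /mh [].
    rewrite hpm /= => h2 h3.
    by split=> //; split=> //=; lia.
  + move=> h o _ [/= [h1 h1'] h2 h3]; split=> //=.
    by split; [exact: vle_trans ap h1|lia].
Qed.

Lemma box_step j q n : box_solvable j (pow2 n) q ->
  box_solvable j.+1 (pow2 n) (step_cost n q).
Proof. by move=> Hj [a al] [b bl] [/= w1 w2]; apply: box_step_aux Hj w1 w2. Qed.

Lemma box0 w : box_solvable 0 w 0.
Proof.
by move=> [] [] _; apply: (solves_ret (o := tt)) => h _; split=> //; case: (h tt).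
Qed.

(** * Planar search for a point whose displacements share a weak sign *)

Section Slice.

Let slice := (Z * Z -> Z * Z * Z)%type.
Implicit Type g : slice.

(* The plane is the slice; [g1] and [g2] are the coordinates of the image in it,
   and [g3] is the displacement in the third direction. *)
Definition g1 g x y := (g (x, y)).1.1.
Definition g2 g x y := (g (x, y)).1.2.
Definition g3 g x y := (g (x, y)).2.

Definition slice_mono g := forall x y x' y', x <= x' -> y <= y' ->
  [/\ g1 g x y <= g1 g x' y', g2 g x y <= g2 g x' y' & g3 g x y <= g3 g x' y'].

Definition up_pt g x y := [/\ x <= g1 g x y, y <= g2 g x y & 0 <= g3 g x y].
Definition down_pt g x y := [/\ g1 g x y <= x, g2 g x y <= y & g3 g x y <= 0].

(* [Exact] certifies that [b] itself is mapped below itself in the plane. A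
   [Horiz] or [Vert] segment from [d] to [b] contains such a point or an [up_pt]:
   walking from [d] to [b], one planar displacement passes from [<= 0] to [>= 0],
   and the other one is [<= 0] at [b]. *)
Inductive cert := Exact | Horiz | Vert.

Definition ucert t g d1 d2 b1 b2 :=
  match t with
  | Exact => [/\ d1 = b1, d2 = b2, g1 g b1 b2 <= b1 & g2 g b1 b2 <= b2]
  | Horiz => [/\ d1 <= b1 /\ d2 = b2, 0 <= g3 g d1 d2, g2 g d1 d2 <= d2,
                 b2 <= g2 g b1 b2 & g1 g b1 b2 <= b1]
  | Vert => [/\ d2 <= b2 /\ d1 = b1, 0 <= g3 g d1 d2, g1 g d1 d2 <= d1,
                b1 <= g1 g b1 b2 & g2 g b1 b2 <= b2]
  end.

Definition lcert t g a1 a2 c1 c2 :=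
  match t with
  | Exact => [/\ c1 = a1, c2 = a2, a1 <= g1 g a1 a2 & a2 <= g2 g a1 a2]
  | Horiz => [/\ a1 <= c1 /\ c2 = a2, g3 g c1 c2 <= 0, c2 <= g2 g c1 c2,
                 g2 g a1 a2 <= a2 & a1 <= g1 g a1 a2]
  | Vert => [/\ a2 <= c2 /\ c1 = a1, g3 g c1 c2 <= 0, c1 <= g1 g c1 c2,
                g1 g a1 a2 <= a1 & a2 <= g2 g a1 a2]
  end.

(** The search box is [[a, b]]; its certified segments are [[a, c]] and [[d, b]]. Since [state_inv]
    demands [c <= d], the box stays nonempty whichever points of the two segments become its
    corners. *)
Record state := State {
  lcert_of : cert; a1 : Z; a2 : Z; c1 : Z; c2 : Z;
  ucert_of : cert; d1 : Z; d2 : Z; b1 : Z; b2 : Z }.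

Definition state_inv s g :=
  [/\ slice_mono g, lcert (lcert_of s) g (a1 s) (a2 s) (c1 s) (c2 s),
      ucert (ucert_of s) g (d1 s) (d2 s) (b1 s) (b2 s) &
      c1 s <= d1 s /\ c2 s <= d2 s].

Definition target s g (p : Z * Z) :=
  [/\ a1 s <= p.1 <= b1 s, a2 s <= p.2 <= b2 s &
      up_pt g p.1 p.2 \/ down_pt g p.1 p.2].

(* Negation exchanges the two ends of the box, transposition the two axes. *)
Definition opp_slice g : slice := fun p =>
  (- g1 g (- p.1) (- p.2), - g2 g (- p.1) (- p.2), - g3 g (- p.1) (- p.2)).

Definition tr_slice g : slice := fun p =>
  (g2 g p.2 p.1, g1 g p.2 p.1, g3 g p.2 p.1).

Definition opp_state s := State (ucert_of s) (- b1 s) (- b2 s) (- d1 s) (- d2 s)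
  (lcert_of s) (- c1 s) (- c2 s) (- a1 s) (- a2 s).

Definition tr_cert t :=
  match t with Exact => Exact | Horiz => Vert | Vert => Horiz end.

Definition tr_state s := State (tr_cert (lcert_of s)) (a2 s) (a1 s) (c2 s) (c1 s)
  (tr_cert (ucert_of s)) (d2 s) (d1 s) (b2 s) (b1 s).

Lemma state_inv_le s g : state_inv s g ->
  [/\ a1 s <= c1 s <= d1 s, a2 s <= c2 s <= d2 s, d1 s <= b1 s & d2 s <= b2 s].
Proof.
move=> [_ hl hu [h1 h2]]; move: hl hu.
by case: (lcert_of s); case: (ucert_of s) => hl hu; destruct hl, hu; split; lia.
Qed.

Lemma tr_certK t : tr_cert (tr_cert t) = t. Proof. by case: t. Qed.

Lemma tr_stateK s : tr_state (tr_state s) = s.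
Proof. by case: s => *; rewrite /tr_state /= !tr_certK. Qed.

Lemma state_inv_opp s g : state_inv s g -> state_inv (opp_state s) (opp_slice g).
Proof.
move=> [mg hl hu [h1 h2]]; split.
- move=> x y x' y' xx yy; rewrite /opp_slice /g1 /g2 /g3 /=.
  have [||m1 m2 m3] := mg (- x') (- y') (- x) (- y); [lia|lia|].
  by rewrite /g1 /g2 /g3 in m1 m2 m3; split; lia.
- move: hu => /=; case: (ucert_of s) => /=;
    by rewrite /opp_slice /g1 /g2 /g3 /= !Z.opp_involutive => -[] *; split; lia.
- move: hl => /=; case: (lcert_of s) => /=;
    by rewrite /opp_slice /g1 /g2 /g3 /= !Z.opp_involutive => -[] *; split; lia.
- by move=> /=; lia.
Qed.

Lemma state_inv_tr s g : state_inv s g -> state_inv (tr_state s) (tr_slice g).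
Proof.
move=> [mg hl hu [h1 h2]]; split.
- by move=> x y x' y' xx yy; have [] := mg y x y' x' yy xx.
- by move: hl => /=; case: (lcert_of s) => -[].
- by move: hu => /=; case: (ucert_of s) => -[].
- by [].
Qed.

Lemma solves_opp_state q s :
  solves q (state_inv (opp_state s)) (target (opp_state s)) ->
  solves q (state_inv s) (target s).
Proof.
move=> H; apply: (solves_sim (enc := fun p => (- p.1, - p.2))
  (dec := fun v => (- v.1.1, - v.1.2, - v.2)) (post := fun p => (- p.1, - p.2)) H).
- by move=> g /state_inv_opp.
- move=> g [x y] _ [/= h1 h2 h3]; split => /=; [lia|lia|].
  case: h3 => [[]|[]]; rewrite /up_pt /down_pt /g1 /g2 /g3 /= => *;
    [right|left]; split; lia.
Qed.

Lemma solves_tr_state q s :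
  solves q (state_inv (tr_state s)) (target (tr_state s)) ->
  solves q (state_inv s) (target s).
Proof.
move=> H; apply: (solves_sim (enc := fun p => (p.2, p.1))
  (dec := fun v => (v.1.2, v.1.1, v.2)) (post := fun p => (p.2, p.1)) H).
- by move=> g /state_inv_tr.
- move=> g [x y] _ [/= h1 h2 h3]; split => //=.
  by case: h3 => [[]|[]]; rewrite /up_pt /down_pt /g1 /g2 /g3 /= => *;
    [left|right]; split.
Qed.

Definition solvable_size nx ny q := forall s,
  b1 s - a1 s <= pow2 nx -> b2 s - a2 s <= pow2 ny ->
  solves q (state_inv s) (target s).

Lemma solvable_size_sym nx ny q : solvable_size nx ny q -> solvable_size ny nx q.
Proof. by move=> G s h1 h2; apply: solves_tr_state; apply: G. Qed.

Lemma solvable_size_leq nx ny q q' : (q <= q')%N ->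
  solvable_size nx ny q -> solvable_size nx ny q'.
Proof. by move=> qq G s h1 h2; apply: (solves_weaken (G s h1 h2)). Qed.

Definition uset s t x y b1' b2' :=
  State (lcert_of s) (a1 s) (a2 s) (c1 s) (c2 s) t x y b1' b2'.
Definition lset s t a1' a2' x y :=
  State t a1' a2' x y (ucert_of s) (d1 s) (d2 s) (b1 s) (b2 s).

Lemma solves_uset q s t x y b1' b2' (K : slice -> Prop) :
  b1' <= b1 s -> b2' <= b2 s ->
  solves q (state_inv (uset s t x y b1' b2')) (target (uset s t x y b1' b2')) ->
  (forall g, K g -> state_inv (uset s t x y b1' b2') g) ->
  solves q K (target s).
Proof.
move=> h1 h2 H KK; apply: (solves_weaken H) => // g p _ [/= h3 h4 h5].
by split=> //; lia.
Qed.

Definition halved nx ny s m1 m2 :=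
  [/\ a1 s <= m1 <= b1 s, a2 s <= m2 <= b2 s,
      m1 - a1 s <= pow2 nx /\ b1 s - m1 <= pow2 nx &
      m2 - a2 s <= pow2 ny /\ b2 s - m2 <= pow2 ny].

Lemma halved_full nx ny s m1 m2 : halved nx ny s m1 m2 ->
  b1 s - a1 s <= pow2 nx.+1 /\ b2 s - a2 s <= pow2 ny.+1.
Proof. by rewrite !pow2S => -[? ? ? ?]; lia. Qed.

(* Since [g3] is monotone it stays nonnegative to the right of [d]. So the probed
   point is a solution, or its planar signs allow it to replace [d] or [b]. *)
Lemma probe_horiz q s m : ucert_of s = Horiz -> a1 s <= m -> d1 s <= m <= b1 s ->
  a2 s <= b2 s ->
  solves q (state_inv (uset s Horiz m (b2 s) (b1 s) (b2 s)))
    (target (uset s Horiz m (b2 s) (b1 s) (b2 s))) ->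
  solves q (state_inv (uset s Horiz (d1 s) (b2 s) m (b2 s)))
    (target (uset s Horiz (d1 s) (b2 s) m (b2 s))) ->
  solves q.+1 (state_inv s) (target s).
Proof.
move=> es am hm ab Hd Hb.
have w3 g : state_inv s g -> 0 <= g3 g m (b2 s).
  move=> [mg _ + _]; rewrite es => -[[_ e] h _ _ _].
  by have [||] := mg (d1 s) (d2 s) m (b2 s); lia.
apply: (solves_query (a := (m, b2 s))) => -[[u v] w].
have [le|gt] := Z_le_gt_dec v (b2 s).
  apply: (solves_uset _ _ Hd) => [||g [Ig e]]; [lia|lia|].
  have w0 := w3 g Ig; case: Ig => [mg hl]; rewrite es => -[[h1 e2] h3 h4 h5 h6] [h7 h8].
  split=> //=; last by lia.
  by split=> //; rewrite ?/g2 ?e /=; lia.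
have [le|gt'] := Z_le_gt_dec m u.
  apply: (solves_ret (o := (m, b2 s))) => g [Ig e].
  have w0 := w3 g Ig; split=> /=; [lia|lia|left; split=> //].
  - by rewrite /g1 e.
  - by rewrite /g2 e /=; lia.
apply: (solves_uset _ _ Hb) => [||g [Ig e]]; [lia|lia|].
case: Ig => [mg hl]; rewrite es => -[[h1 e2] h3 h4 h5 h6] [h7 h8].
split=> //=; last by lia.
by split=> //; rewrite -?e2 //; rewrite ?/g2 ?/g1 ?e2 ?e /=; lia.
Qed.

(** The inequalities follow from the invariant; for a state violating them the promise is
    contradictory, and [(0, 0)] is a dummy output. *)
Lemma solves_state q s :
  (a1 s <= c1 s <= d1 s -> a2 s <= c2 s <= d2 s -> d1 s <= b1 s -> d2 s <= b2 s ->
   solves q (state_inv s) (target s)) ->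
  solves q (state_inv s) (target s).
Proof.
move=> H.
have [[h1 h2 h3 h4]|n] := pselect
  [/\ a1 s <= c1 s <= d1 s, a2 s <= c2 s <= d2 s, d1 s <= b1 s & d2 s <= b2 s].
  exact: H.
by apply: (solves_ret (o := (0, 0))) => g /state_inv_le.
Qed.

(** Unless [d] is already to the right of [m1], a probe there moves either [d] or [b] to it. In the
    second case the width is halved and [G] finishes. *)
Lemma push_horiz nx ny q s m1 m2 : solvable_size nx ny.+1 q -> halved nx ny s m1 m2 ->
  ucert_of s = Horiz ->
  (forall x, m1 <= x -> solves q (state_inv (uset s Horiz x (b2 s) (b1 s) (b2 s)))
     (target (uset s Horiz x (b2 s) (b1 s) (b2 s)))) ->
  solves q.+1 (state_inv s) (target s).
Proof.
move=> G hm es Hc; apply: solves_state => i1 i2 i3 i4.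
have [f1 f2] := halved_full hm; case: hm => [k1 k2 k3 k4].
have [le|gt] := Z_le_gt_dec m1 (d1 s).
  apply: (solves_weaken (Hc _ le)) => // g [mg hl].
  rewrite es => -[[h1 e2] h3 h4 h5 h6] [h7 h8].
  by split=> //=; [split=> //; rewrite -?e2 //; lia|lia].
apply: (@probe_horiz q s m1) => //; [lia|lia|lia|exact: Hc (Z.le_refl _)|].
by apply: G => /=; lia.
Qed.

(** An exact certificate has [d = b], already beyond the midpoint; a segment shares one coordinate
    with [b], so only the other one has to be pushed. *)
Lemma push_upper nx ny q s m1 m2 : solvable_size nx ny.+1 q -> solvable_size nx.+1 ny q ->
  halved nx ny s m1 m2 ->
  (forall t x y, m1 <= x -> m2 <= y ->
     solves q (state_inv (uset s t x y (b1 s) (b2 s)))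
       (target (uset s t x y (b1 s) (b2 s)))) ->
  solves q.+1 (state_inv s) (target s).
Proof.
move=> G1 G2 hm Hc; case es : (ucert_of s).
- case: hm => [k1 k2 k3 k4].
  apply: (solves_weaken (Hc Exact (b1 s) (b2 s) _ _)) => //; [lia|lia|].
  move=> g Ig; have [i1 i2 i3 i4] := state_inv_le Ig.
  case: Ig => [mg hl]; rewrite es => -[h1 h2 h3 h4] h5.
  by split=> //=; lia.
- apply: (push_horiz G1 hm es) => x xm; apply: Hc => //.
  by case: hm => *; lia.
- apply: solves_tr_state.
  have hm' : halved ny nx (tr_state s) m2 m1 by case: hm.
  apply: (push_horiz (solvable_size_sym G2) hm') => [/=|x xm]; first by rewrite es.
  rewrite -[uset _ _ _ _ _ _]tr_stateK; apply: solves_tr_state.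
  rewrite tr_stateK /= /tr_state /uset /= tr_certK.
  by apply: (Hc Vert) => //; case: hm => *; lia.
Qed.

Lemma push_lower nx ny q s m1 m2 : solvable_size nx ny.+1 q -> solvable_size nx.+1 ny q ->
  halved nx ny s m1 m2 ->
  (forall t x y, x <= m1 -> y <= m2 ->
     solves q (state_inv (lset s t (a1 s) (a2 s) x y))
       (target (lset s t (a1 s) (a2 s) x y))) ->
  solves q.+1 (state_inv s) (target s).
Proof.
move=> G1 G2 hm Hc; apply: solves_opp_state.
have hm' : halved nx ny (opp_state s) (- m1) (- m2).
  by case: hm => *; split=> /=; lia.
apply: (push_upper G1 G2 hm') => t x y mx my.
apply: solves_opp_state; rewrite /opp_state /uset /= !Z.opp_involutive.
by apply: Hc; lia.
Qed.

(* The box is cut at height [m2]: the segment from the midpoint to the right side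
   becomes the new certificate, or its right end an exact one. *)
Lemma mid_upper_right nx ny q s m1 m2 u v w : solvable_size nx.+1 ny q ->
  halved nx ny s m1 m2 -> c1 s <= m1 <= d1 s -> c2 s <= m2 <= d2 s ->
  0 <= w -> v <= m2 ->
  solves q.+1 (fun g => state_inv s g /\ g (m1, m2) = (u, v, w)) (target s).
Proof.
move=> G hm k5 k6 w0 vm.
have [f1 f2] := halved_full hm; case: hm => [k1 k2 k3 k4].
(* For a vertical certificate the bound is known at [d] rather than at [b]; it passes down the side
   because [m2 <= d2]. *)
have g1le g : state_inv s g -> g1 g (b1 s) m2 <= b1 s.
  move=> Ig; have [i1 i2 i3 i4] := state_inv_le Ig; case: Ig => [mg _ hu _].
  have [||m1' _ _] := mg (b1 s) m2 (b1 s) (b2 s); [lia|lia|].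
  have [||m1'' _ _] := mg (b1 s) m2 (b1 s) (d2 s); [lia|lia|].
  by case: (ucert_of s) hu => -[]; intros; [lia|lia|];
    match goal with H : _ /\ d1 s = b1 s |- _ => rewrite -(proj2 H) in m1'' * ; lia end.
apply: (solves_query (a := (b1 s, m2))) => -[[u' v'] w'].
have [le|gt] := Z_le_gt_dec m2 v'.
  apply: (solves_uset (t := Horiz) (x := m1) (y := m2) (b1' := b1 s) (b2' := m2));
    [lia|lia|by apply: G => /=; lia|].
  move=> g [[Ig e] e']; have h := g1le g Ig; case: Ig => [mg hl hu hcd].
  split=> //=; last by lia.
  by split=> //; rewrite /g3 /g2 ?e ?e' //=; lia.
apply: (solves_uset (t := Exact) (x := b1 s) (y := m2) (b1' := b1 s) (b2' := m2));
    [lia|lia|by apply: G => /=; lia|].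
move=> g [[Ig e] e']; have h := g1le g Ig; case: Ig => [mg hl hu hcd].
split=> //=; last by lia.
by split=> //; rewrite /g2 e' /=; lia.
Qed.

Lemma solves_tr_state_at q s m1 m2 u v w :
  solves q (fun g => state_inv (tr_state s) g /\ g (m2, m1) = (v, u, w))
    (target (tr_state s)) ->
  solves q (fun g => state_inv s g /\ g (m1, m2) = (u, v, w)) (target s).
Proof.
move=> H; apply: (solves_sim (enc := fun p => (p.2, p.1))
  (dec := fun v => (v.1.2, v.1.1, v.2)) (post := fun p => (p.2, p.1)) H).
- by move=> g [/state_inv_tr Ig e]; split=> //=; rewrite e.
- move=> g [x y] _ [/= h1 h2 h3]; split => //=.
  by case: h3 => [[]|[]]; rewrite /up_pt /down_pt /g1 /g2 /g3 /= => *;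
    [left|right]; split.
Qed.

(** If [v <= m2] the box is cut at height [m2], and if [u <= m1] the transposed cut applies.
    Otherwise all three displacements at the midpoint are nonnegative. *)
Lemma mid_upper nx ny q s m1 m2 u v w :
  solvable_size nx ny.+1 q -> solvable_size nx.+1 ny q ->
  halved nx ny s m1 m2 -> c1 s <= m1 <= d1 s -> c2 s <= m2 <= d2 s ->
  0 <= w -> solves q.+1 (fun g => state_inv s g /\ g (m1, m2) = (u, v, w)) (target s).
Proof.
move=> G1 G2 hm k5 k6 w0.
have [le|gt] := Z_le_gt_dec v m2; first exact: mid_upper_right G2 hm k5 k6 w0 le.
have [le'|gt'] := Z_le_gt_dec u m1.
  apply: solves_tr_state_at.
  have hm' : halved ny nx (tr_state s) m2 m1 by case: hm.
  exact: mid_upper_right (solvable_size_sym G1) hm' k6 k5 w0 le'.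
case: hm => [k1 k2 k3 k4].
apply: (solves_ret (o := (m1, m2))) => g [_ e]; split=> //=; left.
by rewrite /up_pt /g1 /g2 /g3 e /=; split; lia.
Qed.

Lemma solves_opp_state_at q s m1 m2 u v w :
  solves q (fun g => state_inv (opp_state s) g /\ g (- m1, - m2) = (- u, - v, - w))
    (target (opp_state s)) ->
  solves q (fun g => state_inv s g /\ g (m1, m2) = (u, v, w)) (target s).
Proof.
move=> H; apply: (solves_sim (enc := fun p => (- p.1, - p.2))
  (dec := fun v => (- v.1.1, - v.1.2, - v.2)) (post := fun p => (- p.1, - p.2)) H).
- by move=> g [/state_inv_opp Ig e]; split=> //=; rewrite !Z.opp_involutive e.
- move=> g [x y] _ [/= h1 h2 h3]; split => /=; [lia|lia|].
  case: h3 => [[]|[]]; rewrite /up_pt /down_pt /g1 /g2 /g3 /= => *;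
    [right|left]; split; lia.
Qed.

Lemma mid_step nx ny q s m1 m2 : solvable_size nx ny.+1 q -> solvable_size nx.+1 ny q ->
  halved nx ny s m1 m2 -> c1 s <= m1 <= d1 s -> c2 s <= m2 <= d2 s ->
  solves q.+2 (state_inv s) (target s).
Proof.
move=> G1 G2 hm k5 k6.
apply: (solves_query (a := (m1, m2))) => -[[u v] w].
have [le|gt] := Z_le_gt_dec 0 w; first exact: mid_upper G1 G2 hm k5 k6 le.
apply: solves_opp_state_at.
by apply: (mid_upper _ _ G1 G2); rewrite /=; [case: hm => *; split=> /=| | |]; lia.
Qed.

(** One query pushes [d] beyond the midpoint, one pushes [c] below it, and two more cut the box
    there: four queries halve one side. *)
Lemma solvable_size_round nx ny q :
  solvable_size nx ny.+1 q -> solvable_size nx.+1 ny q ->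
  solvable_size nx.+1 ny.+1 q.+4.
Proof.
move=> G1 G2 s; rewrite !pow2S => w1 w2; apply: solves_state => i1 i2 i3 i4.
have le2 : (q <= q.+2)%N by lia.
have le3 : (q <= q.+3)%N by lia.
have [m1 hm1] := Z_halfP (a1 s + b1 s); have [m2 hm2] := Z_halfP (a2 s + b2 s).
have hm : halved nx ny s m1 m2 by split; lia.
apply: (push_upper (solvable_size_leq le3 G1) (solvable_size_leq le3 G2) hm) => t x y h1 h2.
have hm' : halved nx ny (uset s t x y (b1 s) (b2 s)) m1 m2 by [].
apply: (push_lower (solvable_size_leq le2 G1) (solvable_size_leq le2 G2) hm') => t' x' y' h3 h4.
by apply: (mid_step G1 G2 (m1 := m1) (m2 := m2)).
Qed.

(** Each probe halves the segment, not the box, until an end of it is exact or a solution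
    appears. *)
Lemma refine_horiz n q s : ucert_of s = Horiz -> b1 s - d1 s <= pow2 n ->
  (forall x, x <= b1 s ->
     solves q (state_inv (uset s Exact x (b2 s) x (b2 s)))
       (target (uset s Exact x (b2 s) x (b2 s)))) ->
  solves (q + n.+1) (state_inv s) (target s).
Proof.
move=> es; elim: n s es => [|n IH] s es wd Hc; apply: solves_state => i1 i2 i3 i4.
  rewrite pow20 in wd; rewrite addn1.
  apply: (solves_query (a := (d1 s, b2 s))) => -[[u v] w].
  have [le|gt] := Z_le_gt_dec u (d1 s).
    apply: (solves_uset _ _ (Hc (d1 s) i3)) => [||g [Ig e]]; [lia|lia|].
    case: Ig => [mg hl]; rewrite es => -[[h1 e2] h3 h4 h5 h6] h7.
    split=> //=; last by lia.
    by split=> //; rewrite /g1 /g2 ?e // -e2 in h4 *; rewrite e2 e /= in h4 *; lia.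
  (* As the segment has length at most one, [u > d1] forces [u >= b1]; by monotonicity [b] is then
     an [up_pt]. *)
  apply: (solves_ret (o := (b1 s, b2 s))) => g [Ig e].
  case: Ig => [mg hl]; rewrite es => -[[h1 e2] h3 h4 h5 h6] h7.
  have [||n1 n2 n3] := mg (d1 s) (b2 s) (b1 s) (b2 s); [lia|lia|].
  rewrite e2 in h3.
  have e1 : g1 g (d1 s) (b2 s) = u by rewrite /g1 e.
  by split=> /=; [lia|lia|left; split; lia].
rewrite pow2S in wd.
have [m hm] := Z_halfP (d1 s + b1 s).
rewrite addnS; apply: (@probe_horiz _ s m) => //; [lia|lia|lia| |].
- by apply: IH => //=; lia.
- by apply: IH => //=; [lia|move=> x xb; apply: Hc => //; lia].
Qed.

Definition exact_upper s x y := uset s Exact x y x y.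

Lemma refine_upper n q s : b1 s - a1 s <= pow2 n -> b2 s - a2 s <= pow2 n ->
  (forall x y, x <= b1 s -> y <= b2 s ->
     solves q (state_inv (exact_upper s x y)) (target (exact_upper s x y))) ->
  solves (q + n.+1) (state_inv s) (target s).
Proof.
move=> w1 w2 Hc; apply: solves_state => i1 i2 i3 i4; case es : (ucert_of s).
- apply: (solves_weaken (Hc (b1 s) (b2 s) _ _)) => //; [lia|lia|lia|].
  move=> g [mg hl]; rewrite es => -[h1 h2 h3 h4] h5.
  by split=> //=; lia.
- by apply: refine_horiz es _ _; [lia|move=> x xb; apply: Hc => //; lia].
- apply: solves_tr_state; apply: refine_horiz; [by rewrite /= es|rewrite /=; lia|].
  move=> x xb; apply: solves_tr_state; rewrite /tr_state /uset /= tr_certK.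
  by apply: Hc => //; lia.
Qed.

Lemma refine_both n q s : b1 s - a1 s <= pow2 n -> b2 s - a2 s <= pow2 n ->
  (forall x y x' y', a1 s <= x' -> a2 s <= y' -> x <= b1 s -> y <= b2 s ->
     solves q (state_inv (State Exact x' y' x' y' Exact x y x y))
       (target (State Exact x' y' x' y' Exact x y x y))) ->
  solves (q + n.+1 + n.+1) (state_inv s) (target s).
Proof.
move=> w1 w2 Hc; apply: refine_upper => // x y xb yb.
apply: solves_opp_state; apply: refine_upper => [/=|/=|x' y' /= xa ya]; [lia|lia|].
apply: solves_opp_state; rewrite /opp_state /exact_upper /uset /= !Z.opp_involutive.
by apply: Hc; lia.
Qed.

Lemma box1 n : box_solvable 1 (pow2 n) n.
Proof.
by have := box_step (@box0 (pow2 n)); rewrite /step_cost muln0.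
Qed.

(** Exact certificates form a [bracket] for the planar map. At a planar fixed point only the third
    displacement can be nonzero, and either sign is acceptable. Thinness keeps the cost linear in
    [n]. *)
Lemma solves_exact_thin n s q : lcert_of s = Exact -> ucert_of s = Exact ->
  b1 s - a1 s <= pow2 n -> b2 s - a2 s <= 1 -> (step_cost 1 n.+1 <= q)%N ->
  solves q (state_inv s) (target s).
Proof.
move=> el eu w1 w2 leq.
(* The exponent grows by one because sides are bounded weakly here but strictly in [vwidth_lt]. *)
have wv : @vwidth_lt 1 (pow2 n.+1) (tt, a1 s) (tt, b1 s).
  by split=> //=; rewrite pow2S; have := pow2_gt0 n; lia.
have w2' : b2 s - a2 s < pow2 1 by rewrite pow2S pow20; lia.
have H := solves_weaken (box_step_aux (@box1 n.+1) wv w2') leq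
  (fun f Kf => Kf) (fun f o _ Pf => Pf).
apply: (solves_sim (enc := fun x : vec 2 => (x.1.2, x.2))
  (dec := fun v => ((tt, v.1.1), v.1.2) : vec 2)
  (post := fun x : vec 2 => (x.1.2, x.2)) H).
- move=> g Ig; have [i1 i2 i3 i4] := state_inv_le Ig; case: Ig => [mg].
  rewrite el eu => -[e1 e2 h1 h2] [e3 e4 h3 h4] _.
  split=> //=; last by split=> //=; lia.
  move=> [[? x] y] [[? x'] y'] /= [[_ xx] yy].
  by have [] := mg x y x' y' xx yy.
- move=> g [[[] x] y] _ [/= [[_ h1] h2] [[_ h3] h4] [e1 e2]].
  split=> //=; rewrite /up_pt /down_pt /g1 /g2 e1 e2.
  by have [le|gt] := Z_le_gt_dec 0 (g3 g x y); [left|right]; split; lia.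
Qed.

Definition thin_cost n : nat := (step_cost 1 n.+1 + n.+1 + n.+1)%N.

Lemma solvable_size_thin n nx : (nx <= n)%N -> solvable_size nx 0 (thin_cost n).
Proof.
move=> nn s; rewrite pow20 => w1 w2.
have := pow2_le nn; have := pow2_gt0 n => p0 p1.
apply: refine_both; [lia|lia|] => x y x' y' h1 h2 h3 h4.
by apply: (@solves_exact_thin n) => //=; lia.
Qed.

Lemma solvable_size_all n nx ny : (nx <= n)%N -> (ny <= n)%N ->
  solvable_size nx ny (4 * (nx + ny) + thin_cost n).
Proof.
elim: nx ny => [|nx IHx] ny hx hy.
  by apply: solvable_size_leq (solvable_size_sym (solvable_size_thin hy)); lia.
elim: ny hy => [|ny IHy] hy.
  by apply: solvable_size_leq (solvable_size_thin hx); lia.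
have -> : (4 * (nx.+1 + ny.+1) + thin_cost n = (4 * (nx + ny.+1) + thin_cost n).+4)%N.
  by lia.
apply: solvable_size_round; first by apply: IHx => //; lia.
have -> : (nx + ny.+1 = nx.+1 + ny)%N by lia.
by apply: IHy; lia.
Qed.

Definition slice_cost n : nat := (4 * (n + n) + thin_cost n)%N.

Lemma solves_exact_box n x1 x2 y1 y2 : y1 - x1 <= pow2 n -> y2 - x2 <= pow2 n ->
  solves (slice_cost n)
    (state_inv (State Exact x1 x2 x1 x2 Exact y1 y2 y1 y2))
    (target (State Exact x1 x2 x1 x2 Exact y1 y2 y1 y2)).
Proof. by move=> h1 h2; apply: solvable_size_all. Qed.

End Slice.

(** * Dimension three *)

Lemma box2 n : box_solvable 2 (pow2 n) (step_cost n n).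
Proof. exact: box_step (@box1 n). Qed.

Definition half_fixed (a b : vec 2) m (h : vec 3 -> vec 3) (p : vec 2) :=
  [/\ vle a p, vle p b &
      @vle 3 (p, m) (h (p, m)) \/ @vle 3 (h (p, m)) (p, m)].

(** The bracket makes both corners of the slice exact certificates. Shifting the third value by [m]
    turns it into a displacement. *)
Lemma solves_half_fixed n (a b : vec 2) (al bl m : Z) :
  vwidth_lt (pow2 n) a b -> al <= m <= bl ->
  solves (slice_cost n) (@bracket 3 (a, al) (b, bl)) (half_fixed a b m).
Proof.
case: a => -[[] x1] x2; case: b => -[[] y1] y2 /= [[_ w1] w2] hm.
have w1' : y1 - x1 <= pow2 n by lia.
have w2' : y2 - x2 <= pow2 n by lia.
apply: (solves_sim (enc := fun p : Z * Z => ((tt, p.1), p.2, m) : vec 3)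
  (dec := fun v : vec 3 => (v.1.1.2, v.1.2, v.2 - m))
  (post := fun p : Z * Z => ((tt, p.1), p.2) : vec 2) (solves_exact_box w1' w2')).
- move=> h Hh; have [mh hab ha hb] := slice_bracket Hh hm.
  case: Hh => [mh3 _ _ _].
  case: hab => -[_ /= ab1] /= ab2; case: ha => -[_ /= a1] /= a2.
  case: hb => -[_ /= b1] /= b2; split=> //=.
  move=> x y x' y' xx yy.
  have [[[_ /= h1] /= h2] /= h3] : @vle 3 (h (tt, x, y, m)) (h (tt, x', y', m)).
    by apply: mh3 => /=; lia.
  by rewrite /g1 /g2 /g3 /=; split=> //; lia.
- move=> h [x y] _ [/= h1 h2 h3]; split; [by move=> /=; lia..|].
  case: h3 => -[]; rewrite /g1 /g2 /g3 /= => h3 h4 h5; [left|right];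
    by move=> /=; lia.
Qed.

Definition box3_cost (n N : nat) : nat :=
  (n * (slice_cost N).+1 + step_cost 1 (step_cost N N))%N.

Lemma box3_aux n N (a b : vec 2) (al bl : Z) :
  vwidth_lt (pow2 N) a b -> bl - al <= pow2 n ->
  solves (box3_cost n N) (@bracket 3 (a, al) (b, bl))
    (@fixed_in 3 (a, al) (b, bl)).
Proof.
elim: n a b al bl => [|n IH] a b al bl wab wl.
  (* At most two slices remain, so the planar solver of quadratic cost is called only twice. *)
  by apply: (box_step_aux (n := 1) (@box2 N) wab);
    rewrite pow20 in wl; rewrite pow2S pow20; lia.
case: (Z_le_gt_dec al bl) => hl; last first.
  by apply: (solves_ret (o := (a, al))) => h [_ /= [_ hh]]; lia.
rewrite pow2S in wl; have [m m2] := Z_halfP (al + bl).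
have hm : al <= m <= bl by lia.
have -> : box3_cost n.+1 N = (slice_cost N + (box3_cost n N).+1)%N.
  by rewrite /box3_cost; lia.
apply: (solves_bind (solves_half_fixed wab hm)) => p.
apply: (solves_query (a := (p, m) : vec 3)) => v.
have [[ap pb]|npab] := pselect (vle a p /\ vle p b); last first.
  by apply: (solves_ret (o := (a, al))) => h [[_ [ap pb _]]]; case: npab.
(* The displacements have only weak signs, so both halves keep the slice [m]; this is why the search
   stops at height one. *)
have [hup|hup] := pselect (@vle 3 (p, m) v).
- apply: (solves_weaken (IH p b m bl _ _)) => //.
  + exact: vwidth_lt_sub wab ap (vle_refl b).
  + by lia.
  + move=> h [[[mh _ _ hb] _] e]; split=> //; last by rewrite e.
    exact: vle_pair pb (proj2 hm).
  + move=> h o _ [h1 h2 h3]; split=> //.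
    exact: vle_trans (vle_pair ap (proj1 hm)) h1.
- apply: (solves_weaken (IH a p al m _ _)) => //.
  + exact: vwidth_lt_sub wab (vle_refl a) pb.
  + by lia.
  + move=> h [[[mh _ ha _] [_ _ hp]] e]; split=> //.
    * exact: vle_pair ap (proj1 hm).
    * by move: hp; rewrite e => -[].
  + move=> h o _ [h1 h2 h3]; split=> //.
    exact: vle_trans h2 (vle_pair pb (proj2 hm)).
Qed.

Lemma box3 n : box_solvable 3 (pow2 n) (box3_cost n n).
Proof. by move=> [a al] [b bl] [/= w1 w2]; apply: box3_aux => //; lia. Qed.

(** * Higher dimensions and the total cost *)

Fixpoint box_cost (j n : nat) : nat :=
  if j is i.+1 then step_cost n (box_cost i n) else box3_cost n n.

Lemma box_all j n : box_solvable (j + 3) (pow2 n) (box_cost j n).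
Proof. elim: j => [|j IH]; [exact: box3|exact: box_step IH]. Qed.

Lemma step_cost_le n q q' : (q <= q')%N -> (step_cost n q <= n.+1 * q'.+1)%N.
Proof. by move=> qq; rewrite /step_cost; nia. Qed.

(** The start is [14 n^2 + 10 n + 1], well below the constant 60; the summand [j] absorbs the
    additive term of each added dimension. *)
Lemma box_cost_le j n : (box_cost j n <= (60 + j) * n.+1 ^ j.+2)%N.
Proof.
elim: j => [|j IH] /=.
  by rewrite /box3_cost /slice_cost /thin_cost /step_cost expnS expn1; nia.
apply: leq_trans (step_cost_le _ IH) _.
have e0 : (0 < n.+1 ^ j.+2)%N by rewrite expn_gt0.
by rewrite (expnS _ j.+2); nia.
Qed.

(** * Transfer between integer vectors and the lattice *)

Fixpoint vof (j : nat) (x : nat -> Z) : vec j :=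
  match j return vec j with
  | 0%N => tt
  | i.+1 => (vof i x, x i)
  end.

Fixpoint vget (j : nat) : vec j -> nat -> Z :=
  match j return vec j -> nat -> Z with
  | 0%N => fun _ _ => 0
  | i.+1 => fun v l => if l == i then v.2 else vget v.1 l
  end.

Lemma vof_ext j (x y : nat -> Z) :
  (forall i, (i < j)%N -> x i = y i) -> vof j x = vof j y.
Proof.
elim: j => //= j IH xy; congr (_, _); last exact: xy.
by apply: IH => i ij; apply: xy; apply: ltnW.
Qed.

Lemma vget_vof j x i : (i < j)%N -> vget (vof j x) i = x i.
Proof.
elim: j => //= j IH; rewrite ltnS leq_eqVlt; case: eqP => [->//|_] /=.
exact: IH.
Qed.

Lemma vof_vget j (v : vec j) : vof j (vget v) = v.
Proof.
elim: j v => [[]//|j IH [v z]] /=; rewrite eqxx -{2}(IH v); congr (_, _).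
by apply: vof_ext => i ij; rewrite ltn_eqF.
Qed.

Lemma vle_vof j (x y : nat -> Z) :
  (forall i, (i < j)%N -> x i <= y i) -> vle (vof j x) (vof j y).
Proof.
elim: j => //= j IH xy; split; last exact: xy.
by apply: IH => i ij; apply: xy; apply: ltnW.
Qed.

Lemma vle_vget j (u v : vec j) i : vle u v -> (i < j)%N -> vget u i <= vget v i.
Proof.
elim: j u v => //= j IH u v [h1 h2]; rewrite ltnS leq_eqVlt.
by case: eqP => [//|_] /=; apply: IH.
Qed.

Lemma vwidth_vof j w (x y : nat -> Z) :
  (forall i, (i < j)%N -> y i - x i < w) -> vwidth_lt w (vof j x) (vof j y).
Proof.
elim: j => //= j IH xy; split; last exact: xy.
by apply: IH => i ij; apply: xy; apply: ltnW.
Qed.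

Lemma pow2E n : pow2 n = Z.of_nat (2 ^ n)%N.
Proof. by elim: n => // n IH; rewrite pow2S expnS IH; lia. Qed.

Section Lattice.
Variables (k : nat) (dims : 'I_k -> nat).
Hypothesis dims_gt0 : forall i, (0 < dims i)%N.
Local Notation L := (lattice dims).

Definition lmono (f : L -> L) := forall x y, preceq x y -> preceq (f x) (f y).

Definition extend (c : 'I_k -> nat) (i : nat) : Z :=
  oapp (fun i' => Z.of_nat (c i')) 0 (insub i).

Lemma extendE c (i : 'I_k) : extend c i = Z.of_nat (c i).
Proof. by rewrite /extend valK. Qed.

Lemma lattice_bounds (x : L) i : (1 <= val x i <= dims i)%N.
Proof. by case: x => x /= /forallP. Qed.

(** A monotone retraction onto the lattice, so that the oracle can be consulted at every integer
    vector. *)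
Definition clamp (v : vec k) : {ffun 'I_k -> nat} :=
  [ffun i : 'I_k => Z.to_nat (Z.max 1 (Z.min (vget v i) (Z.of_nat (dims i))))].

Lemma clamp_in v : in_lattice dims (clamp v).
Proof. by apply/forallP => i; rewrite ffunE; have := dims_gt0 i; lia. Qed.

Definition vec_lattice (v : vec k) : L := exist _ (clamp v) (clamp_in v).

Definition lattice_vec (x : L) : vec k := vof k (extend (val x)).

Lemma lattice_vecK : cancel lattice_vec vec_lattice.
Proof.
move=> x; apply: val_inj; apply/ffunP => i /=.
rewrite ffunE vget_vof // extendE; by move: (lattice_bounds x i) => /=; lia.
Qed.

Lemma lattice_vec_le x y : preceq x y -> vle (lattice_vec x) (lattice_vec y).
Proof.
move=> xy; apply: vle_vof => i ik; rewrite -[i]/(val (Ordinal ik)) !extendE.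
by move: (xy (Ordinal ik)) => /=; lia.
Qed.

Lemma vec_lattice_le u v : vle u v -> preceq (vec_lattice u) (vec_lattice v).
Proof.
move=> uv i /=; rewrite !ffunE; have := vle_vget uv (ltn_ord i); lia.
Qed.

Let lo : vec k := vof k (fun=> 1).
Let hi : vec k := vof k (extend dims).

Lemma vec_latticeK v : vle lo v -> vle v hi -> lattice_vec (vec_lattice v) = v.
Proof.
move=> lv vh; rewrite -[RHS]vof_vget; apply: vof_ext => i ik.
have := vle_vget lv ik; have := vle_vget vh ik.
rewrite !vget_vof // -[i]/(val (Ordinal ik)) !extendE ffunE /=; lia.
Qed.

Lemma lo_le x : vle lo (lattice_vec x).
Proof.
apply: vle_vof => i ik; rewrite -[i]/(val (Ordinal ik)) extendE.
by move: (lattice_bounds x (Ordinal ik)) => /=; lia.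
Qed.

Lemma le_hi x : vle (lattice_vec x) hi.
Proof.
apply: vle_vof => i ik; rewrite -[i]/(val (Ordinal ik)) !extendE.
by move: (lattice_bounds x (Ordinal ik)) => /=; lia.
Qed.

Lemma solves_lattice n q : box_solvable k (pow2 n) q -> (width dims <= 2 ^ n)%N ->
  solves q lmono (fun f x => f x = x).
Proof.
move=> Hk wn.
have wlh : vwidth_lt (pow2 n) lo hi.
  apply: vwidth_vof => i ik; rewrite -[i]/(val (Ordinal ik)) extendE pow2E.
  have : (dims (Ordinal ik) <= width dims)%N by apply: leq_bigmax.
  by lia.
apply: (solves_sim (enc := vec_lattice) (dec := lattice_vec) (post := vec_lattice)
  (Hk lo hi wlh)).
- move=> f mf; split.
  + by move=> u v uv; apply/lattice_vec_le/mf/vec_lattice_le.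
  + apply: vle_vof => i ik; rewrite -[i]/(val (Ordinal ik)) extendE.
    have := dims_gt0 (Ordinal ik); lia.
  + exact: lo_le.
  + exact: le_hi.
- move=> f p _ [lp ph fp].
  by apply: (can_inj lattice_vecK); rewrite fp vec_latticeK.
Qed.

(** * Oracles that need not be monotone *)

Definition agrees (f : L -> L) (H : seq (L * L)) :=
  forall p, p \in H -> f p.1 = p.2.

Definition violates (H : seq (L * L)) (r : (L * L) * (L * L)) :=
  [/\ r.1 \in H, r.2 \in H, preceq r.1.1 r.2.1 & ~ preceq r.1.2 r.2.2].

Definition verdict (H : seq (L * L)) (x : L) : tarski_output L :=
  match pselect (exists r, violates H r) with
  | left e => let r := projT1 (cid e) in Violation r.1.1 r.2.1
  | right _ => FixedPoint x
  end.

Arguments verdict : simpl never.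

(** The least monotone map lying above the recorded values; 1 is the bottom value where no recorded
    point lies below [x]. *)
Definition hull_fun (H : seq (L * L)) (x : L) : {ffun 'I_k -> nat} :=
  [ffun i => maxn 1 (\max_(p <- H | `[< preceq p.1 x >]) val p.2 i)].

Lemma hull_in H x : in_lattice dims (hull_fun H x).
Proof.
apply/forallP => i; rewrite ffunE leq_maxl geq_max dims_gt0 /=.
by apply/bigmax_leqP_seq => p _ _; case/andP: (lattice_bounds p.2 i).
Qed.

Definition hull H x : L := exist _ (hull_fun H x) (hull_in H x).

Lemma hull_mono H : lmono (hull H).
Proof.
move=> x y xy i; rewrite /= !ffunE geq_max leq_maxl /=.
apply/bigmax_leqP_seq => p pH /asboolP px; apply: leq_trans (leq_maxr _ _).
apply: (@bigmaxn_sup_seq _ _ p _ _ (fun p : L * L => val p.2 i)) => //.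
by apply/asboolP => j; apply: leq_trans (px j) (xy j).
Qed.

(** The pair recorded at a point bounds the maximum from below; a larger contribution from a point
    underneath would be a violation. *)
Lemma hull_agrees H : ~ (exists r, violates H r) -> agrees (hull H) H.
Proof.
move=> nv [a b] abH /=; apply: val_inj; apply/ffunP => i; rewrite /= ffunE.
apply/eqP; rewrite eqn_leq geq_max; apply/andP; split.
  have /andP[-> _] /= := lattice_bounds b i.
  apply/bigmax_leqP_seq => -[a' b'] pH /asboolP /= px.
  suff: preceq b' b by apply.
  by apply: contrapT => nb; apply: nv; exists ((a', b'), (a, b)).
apply: leq_trans (leq_maxr _ _).
apply: (@bigmaxn_sup_seq _ _ (a, b) _ _ (fun p : L * L => val p.2 i)) => //=.
by apply/asboolP => j.
Qed.

(** Without a violation, [hull H] is a monotone map consistent with the history, and it serves as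
    the [g] of the hypothesis. *)
Lemma verdict_ok f H x : agrees f H ->
  (forall g, lmono g -> agrees g H -> f x = x) -> tarski_solution f (verdict H x).
Proof.
move=> fH Hx; rewrite /verdict; case: pselect => [e|n] /=.
  case: (cid e) => -[[a b] [a' b']] [/= /fH /= <- /fH /= <- h1 h2].
  by split.
exact: Hx (hull_mono H) (hull_agrees n).
Qed.

(* Cutting off after [n] queries is harmless: a longer run would be impossible
   if the answers were consistent with a monotone function. *)
Fixpoint track (n : nat) (H : seq (L * L)) (t : query_alg L L L) {struct t} :
    query_alg L L (tarski_output L) :=
  match t with
  | Return x => Query x (fun y => Return _ _ (verdict ((x, y) :: H) x))
  | Query a next =>
      if n is n'.+1 then Query a (fun b => track n' ((a, b) :: H) (next b))
      else Return _ _ (verdict H a)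
  end.

(** The extra query is made at the returned point [x]: a consistent monotone [g] then satisfies both
    [g x = x] and [g x = f x]. *)
Lemma track_ok f n H t : agrees f H ->
  (forall g, lmono g -> agrees g H ->
     g (run g t) = run g t /\ (num_queries g t <= n)%N) ->
  tarski_solution f (run f (track n H t)) /\
  (num_queries f (track n H t) <= n.+1)%N.
Proof.
have agrees_cons g a b H' : agrees g ((a, b) :: H') -> g a = b /\ agrees g H'.
  move=> gH; split; first by apply: (gH (a, b)); rewrite inE eqxx.
  by move=> p pH; apply: gH; rewrite inE pH orbT.
have cons_agrees a H' : agrees f H' -> agrees f ((a, f a) :: H').
  by move=> fH p; rewrite inE => /orP[/eqP -> //|]; apply: fH.
elim: t n H => [x|a next IH] n H fH Hg /=.
  split=> //; apply: verdict_ok; first exact: cons_agrees.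
  by move=> g mg /agrees_cons[<- gH]; have [] := Hg g mg gH.
case: n Hg => [|n] Hg /=.
  (* A consistent monotone [g] would have to make at least one query with a budget of zero, so the
     history contains a violation. *)
  by split=> //; apply: verdict_ok => // g mg gH; have [] := Hg g mg gH.
have [||h1 h2] := IH (f a) n ((a, f a) :: H); [exact: cons_agrees| |by []].
move=> g mg /agrees_cons[ga gH]; have [] := Hg g mg gH.
by rewrite /= ga ltnS.
Qed.

Lemma tarski_of_monotone q : solves q lmono (fun f x => f x = x) ->
  tarski_solvable_within dims q.+1.
Proof.
move=> [t Ht]; exists (track q [::] t) => f; apply: track_ok => // g mg _.
exact: Ht.
Qed.

End Lattice.

Lemma tarski_solvable_box_cost k (dims : 'I_k -> nat) n :
  (3 <= k)%N -> (forall i, (0 < dims i)%N) -> (width dims <= 2 ^ n)%N ->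
  tarski_solvable_within dims (box_cost (k - 3)%N n).+1.
Proof.
move=> k3 d0 wn; apply: tarski_of_monotone => //; apply: solves_lattice wn => //.
by have := @box_all (k - 3)%N n; rewrite subnK.
Qed.

(* Asymptotics in the width *)
Local Close Scope Z_scope.
Local Open Scope classical_set_scope.
Local Open Scope ring_scope.

Lemma trunc_log2_le_ln (R : realType) (n : nat) : (2 <= n)%N ->
  ((trunc_log 2 n).+2%:R : R) <= 3 / ln 2 * ln n%:R.
Proof.
move=> n2.
have l2 : (0 : R) < ln 2 by rewrite ln_gt0 // ltr1n.
have t1 : (1 <= trunc_log 2 n)%N by rewrite trunc_log_gt0.
have h : ((trunc_log 2 n)%:R : R) * ln 2 <= ln n%:R.
  rewrite mulr_natl -lnXn // -natrX ler_ln ?posrE ?ltr0n ?expn_gt0 //;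
    last exact: leq_trans n2.
  by rewrite ler_nat trunc_logP // (leq_trans _ n2).
rewrite mulrAC ler_pdivlMr //.
(* The logarithm is at least 1, so adding 2 at most triples it. *)
apply: (@le_trans _ _ (3 * ((trunc_log 2 n)%:R * ln 2))); last by rewrite ler_pM2l.
rewrite mulrA ler_pM2r // -natrM ler_nat mulSn mulSn mul1n.
by rewrite -addn2 leq_add2l (leq_add t1 t1).
Qed.

Theorem theorem17 (R : realType) (k : nat) (hk : (3 <= k)%N) :
  exists q : nat -> nat,
    (forall dims : 'I_k -> nat, (forall i, (0 < dims i)%N) ->
       tarski_solvable_within dims (q (width dims))) /\
    (fun n : nat => (q n)%:R : R) =O_\oo (fun n : nat => ln n%:R ^+ k.-1 : R).
Proof.
exists (fun w => (box_cost (k - 3) (trunc_log 2 w).+1).+1); split.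
  move=> dims d0; apply: tarski_solvable_box_cost => //.
  exact/ltnW/trunc_log_ltn.
have ek : k.-1 = (k - 3).+2 by rewrite -{1}(subnK hk) addn3.
(* The constant of [box_cost_le] grows from 60 to 61 to absorb the final query. *)
apply/eqO_exP; exists ((61 + (k - 3))%:R * (3 / ln 2) ^+ k.-1).
  have l2 : (0 : R) < ln 2 by rewrite ln_gt0 // ltr1n.
  by rewrite mulr_gt0 ?ltr0n ?addSn // exprn_gt0 // divr_gt0.
near=> n.
have n2 : (2 <= n)%N by near: n; exists 2%N.
have l0 : (0 : R) <= ln n%:R by rewrite ln_ge0 // ler1n (leq_trans _ n2).
rewrite ger0_norm ?ler0n // ger0_norm ?exprn_ge0 // -mulrA -exprMn.
apply: (@le_trans _ _ ((61 + (k - 3))%:R * (trunc_log 2 n).+2%:R ^+ k.-1)).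
  rewrite -natrX -natrM ler_nat ek addSn mulSn -[leqLHS]addn1 addnC.
  by rewrite leq_add ?expn_gt0 // box_cost_le.
by rewrite ler_pM2l ?ltr0n ?addSn // lerXn2r ?nnegrE ?ler0n ?trunc_log2_le_ln //
  (le_trans _ (@trunc_log2_le_ln R n n2)) // ler0n.
Unshelve. all: by end_near.
Qed.
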